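(* Let $1 \le k \le v$ be integers, let $\ell \in \mathbb{R}^v$ and let $\beta_{\max} \in \mathbb{R}$. Define $\ell' \in \mathbb{R}^v$ by $\ell'_i = \ell_i + \beta_{\max}$ for $i \in \{1,\dots,k\}$ and $\ell'_i = \ell_i$ otherwise, and let $p = \operatorname{softmax}(\ell)$ and $p' = \operatorname{softmax}(\ell')$. Then for every $i \in \{1,\dots,k\}$, $$p_i = \frac{p'_i}{\exp \beta_{\max} - \exp \beta_{\max} \sum_{j=1}^k p'_j + \sum_{j=1}^k p'_j}.$$
   Context: For $x \in \mathbb{R}^v$, $\operatorname{softmax}(x)_i = \exp(x_i) / \sum_{j=1}^v \exp(x_j)$. Here $p$ is the unbiased next-token distribution of a language model with logits $\ell$, and $p'$ is the distribution obtained after adding a logit bias $\beta_{\max}$ to tokens $1,\dots,k$. *)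

(* Defs.v *)
From mathcomp Require Import all_boot all_order all_algebra.
From mathcomp Require Import reals sequences exp.
Set Implicit Arguments.
Unset Strict Implicit.
Unset Printing Implicit Defensive.
Import Order.TTheory GRing.Theory Num.Theory.
Local Open Scope ring_scope.

Definition softmax (R : realType) (v : nat) (x : 'rV[R]_v) : 'rV[R]_v :=
  \row_(i < v) (expR (x 0 i) / \sum_(j < v) expR (x 0 j)).

(* Tokens are numbered from 0, so the tokens 1, ..., k are the j with j < k. *)
Definition add_logit_bias (R : realType) (v k : nat) (b : R) (l : 'rV[R]_v) :
    'rV[R]_v :=
  \row_(j < v) (if (j < k)%N then l 0 j + b else l 0 j).

(* Main.v *)
Require Import Defs.
From mathcomp Require Import all_boot all_order all_algebra.
From mathcomp Require Import reals sequences exp.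
From mathcomp Require Import ring.
Set Implicit Arguments.
Unset Strict Implicit.
Unset Printing Implicit Defensive.
Import Order.TTheory GRing.Theory Num.Theory.
Local Open Scope ring_scope.

(** Write [E = exp bmax], and let [A] and [B] be the sums of the unnormalised
    weights [exp l_j] over the biased and the unbiased tokens. The bias multiplies
    the biased weights by [E], so the biased tokens have total mass
    [S = E A / (E A + B)] under [p'], and [E - E S + S = E (A + B) / (E A + B)] is
    the ratio [p'_i / p_i]. *)

Lemma sum_expR_add_logit_bias (R : realType) (v k : nat) (l : 'rV[R]_v) (b : R) :
  \sum_(j < v) expR (add_logit_bias k b l 0 j) =
  expR b * (\sum_(j < v | (j < k)%N) expR (l 0 j))
    + \sum_(j < v | ~~ (j < k)%N) expR (l 0 j).
Proof.
rewrite (bigID (fun j : 'I_v => (j < k)%N)) /= mulr_sumr.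
congr (_ + _); apply: eq_bigr => j; rewrite mxE.
  by move=> ->; rewrite expRD mulrC.
by move=> /negbTE ->.
Qed.

Lemma sum_softmax_add_logit_bias (R : realType) (v k : nat) (l : 'rV[R]_v) (b : R) :
  \sum_(j < v | (j < k)%N) softmax (add_logit_bias k b l) 0 j =
  expR b * (\sum_(j < v | (j < k)%N) expR (l 0 j))
    / (expR b * (\sum_(j < v | (j < k)%N) expR (l 0 j))
       + \sum_(j < v | ~~ (j < k)%N) expR (l 0 j)).
Proof.
(* Folding [E A + B] back into the normaliser of [p'] gives both sides the same denominator, so they
   compare term by term. *)
rewrite -sum_expR_add_logit_bias mulr_sumr mulr_suml.
by apply: eq_bigr => j jk; rewrite !mxE jk expRD [expR b * _]mulrC.
Qed.

Theorem mainTheorem3 (R : realType) (v k : nat) (k_ge1 : (1 <= k)%N)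
    (k_le_v : (k <= v)%N) (l : 'rV[R]_v) (bmax : R) :
  let l' := add_logit_bias k bmax l in
  let p := softmax l in
  let p' := softmax l' in
  forall i : 'I_v, (i < k)%N ->
    p 0 i = p' 0 i /
      (expR bmax - expR bmax * (\sum_(j < v | (j < k)%N) p' 0 j)
       + \sum_(j < v | (j < k)%N) p' 0 j).
Proof.
move=> l' p p' i ik.
rewrite /p' sum_softmax_add_logit_bias !mxE sum_expR_add_logit_bias ik expRD.
rewrite (bigID (fun j : 'I_v => (j < k)%N)) /=.
set A := \sum_(j < v | (j < k)%N) _; set B := \sum_(j < v | ~~ _) _.
(* The biased token [i] itself puts a positive term into [A]. When [k = v] the sum [B] is empty, so
   it is only nonnegative, and [A] alone must keep both normalisers nonzero. *)
have A_gt0 : 0 < A.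
  by rewrite /A (bigD1 i) //= ltr_wpDr ?expR_gt0 ?sumr_ge0 // => j _; exact: expR_ge0.
have B_ge0 : 0 <= B by apply: sumr_ge0 => j _; exact: expR_ge0.
have E_gt0 : 0 < expR bmax by exact: expR_gt0.
have AB_neq0 : A + B != 0 by rewrite gt_eqF // ltr_wpDr.
have EAB_neq0 : expR bmax * A + B != 0 by rewrite gt_eqF // ltr_wpDr // mulr_gt0.
(* The unbiased mass is [1 - S = B / (E A + B)], so [E (1 - S) + S] has numerator [E B + E A]. In
   factored form it is visibly nonzero. *)
have -> : expR bmax - expR bmax * (expR bmax * A / (expR bmax * A + B))
    + expR bmax * A / (expR bmax * A + B)
    = expR bmax * (A + B) / (expR bmax * A + B) by field.
by field; rewrite AB_neq0 EAB_neq0 gt_eqF.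
Qed.
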